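(* Let $(W,S)$ be a Coxeter system with $W$ infinite. Then the poset $(\overline{W},\leq)$, consisting of the elements of $W$ and the infinite reduced words of $(W,S)$ ordered by the weak order, is a complete meet semilattice.
   Context: $S$ is allowed to be infinite. $\Phi$ is the root system of $(W,S)$ (in the standard reflection representation), $\Phi^+$ and $\Phi^-=-\Phi^+$ the sets of positive and negative roots. For $w\in W$ put $\Phi_w=\{\alpha\in\Phi^+ : w^{-1}(\alpha)\in\Phi^-\}$. An infinite reduced expression is a sequence $s_1s_2s_3\cdots$ with $s_i\in S$ such that $s_1s_2\cdots s_k$ is a reduced expression for every $k\ge 1$; put $\Phi_{s_1s_2s_3\cdots}=\bigcup_{i\ge1}\Phi_{s_1s_2\cdots s_i}$. Two infinite reduced expressions are equivalent if the associated sets $\Phi_{s_1s_2\cdots}$ are equal. $W_l$ is the set of equivalence classes; its elements are called infinite reduced words, and $\Phi_w$ for $w\in W_l$ is the common set attached to the class. $\overline{W}=W_l\uplus W$ (disjoint union). The weak order on $\overline{W}$ is defined by $x\le y$ if and only if $\Phi_x\subset\Phi_y$. A poset is a complete meet semilattice if every non-empty subset has a greatest lower bound. *)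

(* Defs.v *)
From HB Require Import structures.
From mathcomp Require Import all_boot all_order all_algebra.
From mathcomp Require Import boolp classical_sets functions cardinality.
From mathcomp Require Import reals trigo freeg ring.

Set Implicit Arguments.
Unset Strict Implicit.
Unset Printing Implicit Defensive.

Import Order.TTheory GRing.Theory Num.Theory.

Local Open Scope classical_set_scope.
Local Open Scope ring_scope.

(* The order of an element of a possibly infinite group, 0 encoding an        *)
(* infinite order.                                                            *)
Definition group_order (W : groupType) (x : W) : nat :=
  if pselect (exists n, (0 < n)%N && (x ^+ n == 1)%g) is left h
  then ex_minn h else 0.

Section CoxeterSystem.
Variables (W : groupType) (S : set W).

Definition cox_m (s t : S) : nat := group_order (val s * val t)%g.

Definition word_prod (l : seq S) : W := (\prod_(s <- l) val s)%g.

(* The congruence on words generated by the relations (st)^m(s,t) = 1 with    *)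
(* m(s,t) finite. As m(s,s) = 1 when s is an involution, ss = 1 is among      *)
(* them, hence the quotient of the monoid of words is the group with          *)
(* generators S and these relations.                                          *)
Inductive cox_equiv : seq S -> seq S -> Prop :=
| cox_refl l : cox_equiv l l
| cox_sym l1 l2 : cox_equiv l1 l2 -> cox_equiv l2 l1
| cox_trans l1 l2 l3 : cox_equiv l1 l2 -> cox_equiv l2 l3 -> cox_equiv l1 l3
| cox_rel u v (s t : S) : (0 < cox_m s t)%N ->
    cox_equiv (u ++ flatten (nseq (cox_m s t) [:: s; t]) ++ v) (u ++ v).

(* Bourbaki's definition: the elements of S have order 2, S generates W, and  *)
(* the relations (st)^m(s,t) = 1, where m(s,t) is the order of st in W, form  *)
(* a presentation of W.                                                       *)
Definition coxeter_system : Prop :=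
  [/\ forall s : S, group_order (val s) = 2,
      forall w : W, exists l, word_prod l = w
    & forall l1 l2, word_prod l1 = word_prod l2 -> cox_equiv l1 l2].

Definition reduced_word (l : seq S) : Prop :=
  forall l', word_prod l' = word_prod l -> (size l <= size l')%N.

Definition inf_reduced (e : nat -> S) : Prop :=
  forall k, (0 < k)%N -> reduced_word (mkseq e k).

Definition inf_expr := {e : nat -> S | `[< inf_reduced e >]}.

Section Roots.
Variable R : realType.

(* The real vector space with basis the simple roots; <<s>> is the simple     *)
(* root attached to s.                                                        *)
Local Notation V := {freeg S / R}.

Definition simple_form (s t : S) : R :=
  if cox_m s t is 0 then -1 else - cos (pi / (cox_m s t)%:R).

Definition cox_form (u v : V) : R :=
  fglift (fun s => fglift (fun t => simple_form s t : R^o) v : R^o) u.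

Definition simple_reflection (s : S) (v : V) : V :=
  v - (2 * cox_form <<s>> v) *: <<s>>.

Definition word_act (l : seq S) (v : V) : V := foldr simple_reflection v l.

(* The action of W in the standard reflection representation, computed along  *)
(* some word for w; by geom_repE below any other word gives the same result.  *)
Definition geom_rep (w : W) : V -> V :=
  word_act (xget [::] [set l | word_prod l = w]).

Definition root : set V := [set v | exists w s, v = geom_rep w <<s>>].

Definition pos_root : set V := [set v | root v /\ forall s, 0 <= coeff s v].

Definition neg_root : set V := -%R @` pos_root.

Definition inversions (w : W) : set V :=
  [set a | pos_root a /\ neg_root (geom_rep w^-1%g a)].

Definition inf_inversions (e : inf_expr) : set V :=
  \bigcup_(k in [set k | (0 < k)%N]) inversions (word_prod (mkseq (val e) k)).

Definition inf_equiv : rel inf_expr :=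
  fun e e' => `[< inf_inversions e = inf_inversions e' >].

Lemma inf_equiv_refl : reflexive inf_equiv.
Proof. by move=> e; apply/asboolP. Qed.

Lemma inf_equiv_sym : symmetric inf_equiv.
Proof. by move=> e e'; apply/asboolP/asboolP. Qed.

Lemma inf_equiv_trans : transitive inf_equiv.
Proof. by move=> e e' e'' /asboolP h /asboolP h'; apply/asboolP; rewrite h. Qed.

Canonical inf_equiv_equiv :=
  EquivRel inf_equiv inf_equiv_refl inf_equiv_sym inf_equiv_trans.

Definition inf_word := {eq_quot inf_equiv}%qT.

Definition Wbar : Type := (inf_word + W)%type.

Definition Wbar_inversions (x : Wbar) : set V :=
  match x with
  | inl c => inf_inversions (repr c)
  | inr w => inversions w
  end.

Definition weak_le (x y : Wbar) : Prop :=
  Wbar_inversions x `<=` Wbar_inversions y.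

End Roots.
End CoxeterSystem.

Section Semilattice.
Variables (T : Type) (le : T -> T -> Prop).

Definition greatest_lower_bound (A : set T) (m : T) : Prop :=
  (forall a, A a -> le m a) /\ (forall b, (forall a, A a -> le b a) -> le b m).

Definition complete_meet_semilattice : Prop :=
  Relation_Definitions.order T le /\
  forall A : set T, A !=set0 -> exists m, greatest_lower_bound A m.

End Semilattice.

Lemma group_orderX (W : groupType) (x : W) n : group_order x = n -> (x ^+ n = 1)%g.
Proof.
rewrite /group_order; case: pselect => [h|_ <-]; last by rewrite expg0.
by case: ex_minnP => m /andP[_ /eqP hm] _ <-.
Qed.

Lemma group_order1 (W : groupType) : group_order (1 : W)%g = 1%N.
Proof.
rewrite /group_order; case: pselect => [h|[]]; last by exists 1%N; rewrite expg1n eqxx.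
case: ex_minnP => m /andP[m0 _] /(_ 1%N); rewrite expg1n eqxx => /(_ isT) m1.
by apply/eqP; rewrite eqn_leq m1 m0.
Qed.

Lemma group_order_conj (W : groupType) (x y : W) :
  group_order (x * y)%g = group_order (y * x)%g.
Proof.
have H (a b : W) n : ((a * b) ^+ n = 1)%g -> ((b * a) ^+ n = 1)%g.
  move=> h; suff -> : (b * a = (a * b) ^ a)%g by rewrite -conjXg h conj1g.
  by rewrite /conjg !mulgA mulVg mul1g.
have E n : ((x * y) ^+ n == 1)%g = ((y * x) ^+ n == 1)%g.
  by apply/eqP/eqP; apply: H.
rewrite /group_order.
case: pselect => [h|h]; case: pselect => [h'|h'] //.
- case: ex_minnP => m hm Hm; case: ex_minnP => m' hm' Hm'.
  apply/eqP; rewrite eqn_leq; apply/andP; split.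
    by apply: Hm; rewrite E.
  by apply: Hm'; rewrite -E.
- by case: h'; case: h => n; rewrite E; exists n.
- by case: h; case: h' => n; rewrite -E; exists n.
Qed.

Section GeomRep.
Variables (W : groupType) (S : set W) (R : realType).
Local Notation V := {freeg S / R}.
Hypothesis hS : coxeter_system S.
Implicit Types (s t : S) (u v : V).

Lemma cox_mC s t : cox_m s t = cox_m t s.
Proof. exact: group_order_conj. Qed.

Lemma cox_sq s : (val s * val s = 1)%g.
Proof. by case: hS => h _ _; have := group_orderX (h s); rewrite expgS expg1. Qed.

Lemma cox_mss s : cox_m s s = 1%N.
Proof. by rewrite /cox_m cox_sq group_order1. Qed.

Lemma cox_m1 s t : cox_m s t = 1%N -> s = t.
Proof.
move=> /group_orderX; rewrite expg1 => h; apply: val_inj => /=.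
by rewrite -[LHS]mulg1 -(cox_sq t) mulgA h mul1g.
Qed.

Lemma fgliftZ (M : lmodType R) (f : S -> M) (a : R) v :
  fglift f (a *: v) = a *: fglift f v.
Proof.

suff H : {morph fglift f : u / a *: u >-> a *: u} by exact: H.
move=> {}v; have hB := lift_is_additive f.
have h0 : fglift f 0 = 0 by rewrite -(subr0 0) hB subrr.
have hN u : fglift f (- u) = - fglift f u by rewrite -sub0r hB h0 sub0r.
have hD u u' : fglift f (u + u') = fglift f u + fglift f u'.
  by rewrite -{1}[u']opprK hB hN opprK.
rewrite -{2}(freeg_sumE v) [a *: v]/(fgscale a v) /fgscale.
rewrite !(big_morph _ hD h0) scaler_sumr; apply: eq_bigr => x _.
by rewrite !liftU scalerA.
Qed.

Lemma fgliftB (M : lmodType R) (f : S -> M) u v :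
  fglift f (u - v) = fglift f u - fglift f v.
Proof. exact: lift_is_additive. Qed.

Lemma fgliftD (M : lmodType R) (f : S -> M) u v :
  fglift f (u + v) = fglift f u + fglift f v.
Proof. by rewrite -{1}[v]opprK fgliftB -[- v]scaleN1r fgliftZ scaleN1r opprK. Qed.

Local Notation B s v := (cox_form (<<s>> : V) v).

Lemma coxB s v : B s v = fglift (fun t => simple_form R s t : R^o) v.
Proof. by rewrite /cox_form liftU scale1r. Qed.

Lemma coxBD s u v : B s (u + v) = B s u + B s v.
Proof. by rewrite !coxB fgliftD. Qed.
Lemma coxBZ s a v : B s (a *: v) = a * B s v.
Proof. by rewrite !coxB fgliftZ. Qed.
Lemma coxBN s v : B s (- v) = - B s v.
Proof. by rewrite -scaleN1r coxBZ mulN1r. Qed.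
Lemma coxBU s t : B s <<t>> = simple_form R s t.
Proof. by rewrite !coxB liftU scale1r. Qed.

Local Notation refl := (@simple_reflection W S R).

Lemma reflD s u v : refl s (u + v) = refl s u + refl s v.
Proof.
rewrite /simple_reflection coxBD; apply/eqP/freeg_eqP => x.
rewrite !(coeffD, coeffN, coeffZ); ring.
Qed.

Lemma reflZ s a v : refl s (a *: v) = a *: refl s v.
Proof.
rewrite /simple_reflection coxBZ; apply/eqP/freeg_eqP => x.
rewrite !(coeffD, coeffN, coeffZ); ring.
Qed.

Lemma simple_form_ss s : simple_form R s s = 1.
Proof. by rewrite /simple_form cox_mss divr1 cospi opprK. Qed.

Lemma reflK s v : refl s (refl s v) = v.
Proof.
rewrite {2}/simple_reflection -scaleN1r reflD !reflZ /simple_reflection.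
rewrite coxBU simple_form_ss; apply/eqP/freeg_eqP => x.
rewrite !(coeffD, coeffN, coeffZ); ring.
Qed.

Lemma word_actD l u v : word_act l (u + v) = word_act l u + word_act l v.
Proof. by elim: l => //= s l ->; rewrite reflD. Qed.

Lemma word_actZ l a v : word_act l (a *: v) = a *: word_act l v.
Proof. by elim: l => //= s l ->; rewrite reflZ. Qed.

Lemma word_act_cat l1 l2 v : word_act (l1 ++ l2) v = word_act l1 (word_act l2 v).
Proof. by rewrite /word_act foldr_cat. Qed.

Lemma word_act_coxeter s t v : (0 < cox_m s t)%N ->
  word_act (flatten (nseq (cox_m s t) [:: s; t])) v = v.
Proof.
move=> m0; have [<-|st] := eqVneq s t.
  by rewrite cox_mss /= !reflK.
have m1 : (1 < cox_m s t)%N.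
  by rewrite ltn_neqAle m0 andbT eq_sym; apply: contra_neq st => /cox_m1.
set m := cox_m s t in m0 m1 *.
set th : R := pi / m%:R.
have mr : 1 < m%:R :> R by rewrite ltr1n.
have mr0 : 0 < m%:R :> R by rewrite ltr0n.
have th0 : 0 < sin th.
  apply: sin_gt0_pi; rewrite divr_gt0 ?pi_gt0 //=.
  by rewrite ltr_pdivrMr // ltr_pMr ?pi_gt0.
have mth : th *+ m = pi by rewrite -mulr_natr /th divfK ?gt_eqF.
have fst : simple_form R s t = - cos th.
  by rewrite /simple_form -/m /th; case: (m) m0.
have fts : simple_form R t s = - cos th.
  by rewrite /simple_form cox_mC -/m /th; case: (m) m0.
clearbody th.
pose P x : V := sin (x + th) *: <<s>> + sin x *: <<t>>.
have sq : sin th ^+ 2 = 1 - cos th ^+ 2.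
  by have := cos2Dsin2 th => <-; ring.
have step x : word_act [:: s; t] (P x) = P (x + th *+ 2).
  rewrite /= /P !(reflD, reflZ) /simple_reflection.
  rewrite !(coxBU, coxBD, coxBZ, simple_form_ss, fst, fts).
  rewrite !(coxBN, coxBZ, coxBU, fst).
  apply/eqP/freeg_eqP => y; rewrite !(coeffD, coeffN, coeffZ) !mulr2n !(sinD, cosD).
  ring: sq.
pose l k := flatten (nseq k [:: s; t]).
have stepk k x : word_act (l k) (P x) = P (x + (th *+ k) *+ 2).
  elim: k x => [|k IH] x; first by rewrite mul0rn addr0.
  rewrite /l /= -/(l k) IH -[LHS]/(word_act [:: s; t] _) step.
  by congr P; rewrite -addrA -mulrnDl -mulrSr.
have fixP x : word_act (l m) (P x) = P x.
  by rewrite stepk mth /P addrAC !sinD2pi.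
have fixs : word_act (l m) (<<s>> : V) = <<s>>.
  have -> : (<<s>> : V) = (sin th)^-1 *: P 0.
    by rewrite /P sin0 scale0r addr0 add0r scalerA mulVf ?scale1r ?gt_eqF.
  by rewrite word_actZ fixP.
have fixt : word_act (l m) (<<t>> : V) = <<t>>.
  have -> : (<<t>> : V) = (- sin th)^-1 *: P (- th).
    by rewrite /P addNr sin0 scale0r add0r sinN scalerA mulVf ?scale1r ?oppr_eq0 ?gt_eqF.
  by rewrite word_actZ fixP.
pose p := (B s v + cos th * B t v) / sin th ^+ 2.
pose q := (cos th * B s v + B t v) / sin th ^+ 2.
have sn0 : sin th != 0 by rewrite gt_eqF.
pose v0 := v + (- p) *: <<s>> + (- q) *: <<t>>.
have v0s : B s v0 = 0.
  rewrite !(coxBD, coxBZ, coxBU) fst simple_form_ss /p /q.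
  apply: (mulIf (expf_neq0 2 sn0)); rewrite mul0r; field: sq; exact: sn0.
have v0t : B t v0 = 0.
  rewrite !(coxBD, coxBZ, coxBU) fts simple_form_ss /p /q.
  apply: (mulIf (expf_neq0 2 sn0)); rewrite mul0r; field: sq; exact: sn0.
have fixv0 k : word_act (l k) v0 = v0.
  elim: k => //= k ->.
  by rewrite /simple_reflection v0t mulr0 scale0r subr0 v0s mulr0 scale0r subr0.
have vE : v = v0 + p *: <<s>> + q *: <<t>>.
  by apply/eqP/freeg_eqP => x; rewrite !(coeffD, coeffN, coeffZ); ring.
clearbody v0; rewrite -/(l m) vE.
by rewrite !(word_actD, word_actZ) fixs fixt fixv0.
Qed.

Lemma word_act_equiv l1 l2 :
  cox_equiv l1 l2 -> @word_act W S R l1 = @word_act W S R l2.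
Proof.
elim=> // [l l' l'' _ -> _ -> //|u v s t m0].
apply/funext => x.
by rewrite !word_act_cat word_act_coxeter.
Qed.

Lemma geom_repE l : geom_rep (word_prod l) = @word_act W S R l.
Proof.
case: hS => _ _ h; apply/word_act_equiv/h.
by case: xgetP => [l' _ //|/(_ l) /(_ erefl)].
Qed.
End GeomRep.

(* Main.v *)
(** Every root is nonnegative or nonpositive, so [inversions] grows by the single
    root [w <<s>>] when [w] is extended by an ascent [s]; the weak order on [W]
    is then inclusion of inversion sets.  Every inversion set, finite or not, is
    closed under nonnegative combinations that are roots, hence so is the
    intersection [Y] of any family of them.  If [Y] lies in some [inversions w],
    two elements of [W] below [Y] have an upper bound below [Y]: this is a
    Newman-type induction from the case of two covers [z s] and [z t] of [z],
    where one takes [z x] with [x] maximal among the elements preserving the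
    plane of [s] and [t].  So there is a greatest element below [Y].
    In general a chosen member of the family is an increasing union of sets
    [inversions (w n)], and the greatest elements [x n] below [Y] intersected
    with [inversions (w n)] form an increasing chain; either it stabilizes, or it
    spells an infinite reduced expression, and its limit is the meet. *)

Require Import Defs.
From mathcomp Require Import all_boot all_order all_algebra.
From mathcomp Require Import boolp classical_sets functions cardinality.
From mathcomp Require Import reals trigo freeg ring.

Set Implicit Arguments.
Unset Strict Implicit.
Unset Printing Implicit Defensive.

Import Order.TTheory GRing.Theory Num.Theory.

Local Open Scope classical_set_scope.
Local Open Scope ring_scope.

Lemma subset_chain T (X : nat -> set T) : (forall n, X n `<=` X n.+1) ->
  forall m n, (m <= n)%N -> X m `<=` X n.
Proof.
move=> XS m n /subnKC <-.
by elim: (n - m)%N => [|k IH]; rewrite ?addn0 // addnS => a /IH/XS.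
Qed.

(** * Reduced words and alternating words in two generators *)

Section Words.
Variables (W : groupType) (S : set W).
Hypothesis hS : coxeter_system S.
Implicit Types (s t : S) (l : seq S) (w : W).

Lemma word_prod_cat l1 l2 : word_prod (l1 ++ l2) = (word_prod l1 * word_prod l2)%g.
Proof. exact: big_cat. Qed.

Lemma word_prod1 s : word_prod [:: s] = val s.
Proof. exact: big_seq1. Qed.

Lemma word_prod_nil : word_prod ([::] : seq S) = 1%g.
Proof. exact: big_nil. Qed.

Lemma word_prod_rcons l s : word_prod (rcons l s) = (word_prod l * val s)%g.
Proof. by rewrite -cats1 word_prod_cat word_prod1. Qed.

Lemma word_prod_cons s l : word_prod (s :: l) = (val s * word_prod l)%g.
Proof. exact: big_cons. Qed.

(** Every relator has even length [2 * cox_m s t]. *)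
Lemma cox_equiv_odd l1 l2 : cox_equiv l1 l2 -> odd (size l1) = odd (size l2).
Proof.
elim=> // [l l' l'' _ -> _ -> //|u v s t _].
rewrite !size_cat !oddD; congr (_ (+) _); rewrite size_flatten /shape map_nseq.
by rewrite sumn_nseq oddM.
Qed.

Lemma word_prod_odd l1 l2 :
  word_prod l1 = word_prod l2 -> odd (size l1) = odd (size l2).
Proof. by case: hS => _ _ h /h; exact: cox_equiv_odd. Qed.

Lemma reduced_word_catl l1 l2 : reduced_word (l1 ++ l2) -> reduced_word l1.
Proof.
move=> h l' e; have := h (l' ++ l2).
by rewrite !word_prod_cat e !size_cat leq_add2r; apply.
Qed.

Lemma reduced_word_catr l1 l2 : reduced_word (l1 ++ l2) -> reduced_word l2.
Proof.
move=> h l' e; have := h (l1 ++ l').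
by rewrite !word_prod_cat e !size_cat leq_add2l; apply.
Qed.

Lemma exists_reduced_word w : exists2 l : seq S, word_prod l = w & reduced_word l.
Proof.
have ex : exists n, `[< exists2 l : seq S, word_prod l = w & size l = n >].
  by case: hS => _ /(_ w) [l e] _; exists (size l); apply/asboolP; exists l.
case: (ex_minnP ex) => n /asboolP[l e <-] m.
by exists l => // l'; rewrite e => e'; apply: m; apply/asboolP; exists l'.
Qed.

Lemma reduced_word_prod l1 l2 : word_prod l1 = word_prod l2 ->
  size l1 = size l2 -> reduced_word l1 -> reduced_word l2.
Proof. by move=> e se h l'; rewrite -e -se; apply: h. Qed.

(* By parity, lengths change by exactly one. *)
Lemma not_reduced_rcons l s : reduced_word l -> ~ reduced_word (rcons l s) ->
  exists l', word_prod l = word_prod (rcons l' s) /\ size l = (size l').+1.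
Proof.
move=> rl nr; have [l' e rl'] := exists_reduced_word (word_prod (rcons l s)).
have lt' : (size l' < size (rcons l s))%N.
  rewrite ltnNge; apply: contra_notN nr => le l'' e''.
  by rewrite (leq_trans le) // rl' // e'' e.
have od := word_prod_odd e; rewrite size_rcons ltnS /= in lt' od.
have e2 : word_prod l = word_prod (rcons l' s).
  by rewrite word_prod_rcons e word_prod_rcons -mulgA (cox_sq hS) mulg1.
exists l'; split => //; apply/eqP; rewrite eqn_leq -{1}(size_rcons l' s) rl //=.
rewrite ltn_neqAle lt' andbT; apply/eqP => es; move: od; rewrite es.
by case: (odd _).
Qed.

Fixpoint altword s t k : seq S :=
  if k is k'.+1 then rcons (altword t s k') s else [::].

Lemma size_altword s t k : size (altword s t k) = k.
Proof. by elim: k s t => //= k IH s t; rewrite size_rcons IH. Qed.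

Lemma altword_split s t k m : exists p, altword s t (m + k) = p ++ altword s t m.
Proof.
elim: m s t => [|m IH] s t; first by exists (altword s t k); rewrite cats0.
by have [p e] := IH t s; exists p; rewrite addSn /= e rcons_cat.
Qed.

(** Stripping the last letters [t] and [s] leaves the same quotient with [s] and [t] exchanged,
    between [val t] and [val s]. At [k = cox_m s t] the right-hand side is 1, which is the braid
    relation. *)
Lemma altword_div s t k :
  ((word_prod (altword t s k))^-1 * word_prod (altword s t k))%g
  = ((val t * val s) ^+ k)%g.
Proof.
elim: k s t => [|k IH] s t; first by rewrite /= word_prod_nil mulVg expg0.
rewrite /= !word_prod_rcons invgM.
have -> : ((val t)^-1 = val t)%g by apply: (@mulgI _ (val t)); rewrite mulgV cox_sq.
rewrite -!mulgA [X in (_ * X)%g]mulgA IH.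
elim: k {IH} => [|k IH]; first by rewrite !expg1 expg0 mul1g.
by rewrite [in LHS]expgS [in RHS]expgS -IH !mulgA.
Qed.

Lemma altword_braid s t :
  word_prod (altword t s (cox_m s t)) = word_prod (altword s t (cox_m s t)).
Proof.
apply: (@mulgI _ (word_prod (altword t s (cox_m s t)))^-1)%g.
by rewrite mulVg altword_div; rewrite cox_mC group_orderX.
Qed.

Lemma not_reduced_ss l s : ~ reduced_word (rcons (rcons l s) s).
Proof.
move=> /(_ l); rewrite !word_prod_rcons -mulgA (cox_sq hS) mulg1 !size_rcons.
by move/(_ erefl); rewrite ltnNge leqnSn.
Qed.

(** Read from the right: equal neighbours cannot occur in a reduced word, so each letter is forced
    by the one after it. *)
Lemma reduced_rcons_altword s t l : all (fun x => (x == s) || (x == t)) l ->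
  reduced_word (rcons l s) -> l = altword t s (size l).
Proof.
elim/last_ind: l s t => // l x IH s t; rewrite all_rcons => /andP[xst al] r.
have xs : x != s by apply/eqP => xs; move: r; rewrite xs; apply: not_reduced_ss.
have xt : x = t by apply/eqP; move: xst; rewrite (negbTE xs).
subst x; rewrite size_rcons /= -IH //.
  by apply: sub_all al => y; rewrite orbC.
by move: r; rewrite -cats1; apply: reduced_word_catl.
Qed.

(** A longer word would have a suffix of length [cox_m s t + 1]; the braid relation, applied to all
    but the last letter of that suffix, produces a word ending in [s s]. *)
Lemma reduced_altword_size s t k : (0 < cox_m s t)%N ->
  reduced_word (altword s t k) -> (k <= cox_m s t)%N.
Proof.
move=> m0 r; rewrite leqNgt; apply/negP => /subnKC e.
have [p ep] := altword_split s t (k - (cox_m s t).+1) (cox_m s t).+1.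
move: r; rewrite -e ep => /reduced_word_catr /=.
move/(@reduced_word_prod _ (rcons (altword s t (cox_m s t)) s)).
rewrite !word_prod_rcons altword_braid !size_rcons !size_altword => /(_ erefl erefl).
by rewrite -(prednK m0) /=; apply: not_reduced_ss.
Qed.

End Words.

(** * Ascents send simple roots to nonnegative roots *)

Section Positivity.
Variables (W : groupType) (S : set W) (R : realType).
Hypothesis hS : coxeter_system S.
Local Notation V := {freeg S / R}.
Implicit Types (s t : S) (l : seq S) (w x : W) (u v : V).

Definition nonneg v : Prop := forall s, 0 <= coeff s v.

Lemma nonnegU s : nonneg <<s>>.
Proof. by move=> t; rewrite coeffU mul1r ler0n. Qed.

Lemma nonneg_comb a b u v :
  0 <= a -> 0 <= b -> nonneg u -> nonneg v -> nonneg (a *: u + b *: v).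
Proof.
by move=> a0 b0 hu hv s; rewrite coeffD !coeffZ addr_ge0 // mulr_ge0.
Qed.

Lemma nonneg_eq0 v : nonneg v -> nonneg (- v) -> v = 0.
Proof.
move=> h h'; apply/eqP/freeg_eqP => s; rewrite coeff0.
by apply/eqP; rewrite eq_le h andbT -oppr_ge0 -coeffN h'.
Qed.

Lemma simple_formC s t : simple_form R s t = simple_form R t s.
Proof. by rewrite /simple_form cox_mC. Qed.

(* Under [word_act (altword t s k)] the coordinates run through a sequence with
   [c (j + 2) = 2 q c (j + 1) - c j], that is [sin (j th) / sin th] with
   [q = cos th], or [c j = j] when [q = 1]. *)
Lemma word_act_altword s t (q : R) (c : nat -> R) k j :
  simple_form R s t = - q -> (forall i, c i.+2 = 2 * q * c i.+1 - c i) ->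
  (forall i, (i <= j + k.+1)%N -> 0 <= c i) ->
  exists a b, [/\ 0 <= a, 0 <= b &
    word_act (altword t s k) (c j.+1 *: <<s>> + c j *: <<t>>)
      = a *: <<s>> + b *: <<t>> :> V].
Proof.
elim: k j s t => [|k IH] j s t st ec c0.
  by exists (c j.+1), (c j); split=> //; apply: c0; rewrite ?addn1.
have [||a [b [a0 b0 e]]] := IH j.+1 t s _ ec; first by rewrite simple_formC.
  by move=> i; rewrite addSnnS; apply: c0.
exists b, a; split => //; rewrite [RHS]addrC -e /altword -/altword.
rewrite -cats1 word_act_cat /=; congr word_act.
rewrite reflD !reflZ /simple_reflection !coxBU simple_form_ss // simple_formC st ec.
apply/eqP/freeg_eqP => y; rewrite !(coeffD, coeffN, coeffZ); ring.
Qed.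

(** The vector [<<s>>] is [c 1 *: <<s>> + c 0 *: <<t>>]. For finite order take
    [th = pi / cox_m s t]: the bound on [k] keeps every angle [th * i] within [[0, pi]], where the
    sine is nonnegative. *)
Lemma altword_nonneg s t k : s != t -> ((0 < cox_m s t)%N -> (k < cox_m s t)%N) ->
  exists a b, [/\ 0 <= a, 0 <= b &
    word_act (altword t s k) <<s>> = a *: <<s>> + b *: <<t>> :> V].
Proof.
move=> st; case em: (cox_m s t) => [|m] km.
  have [||a [b H]] := @word_act_altword s t 1 (fun i => i%:R) k 0 _ _ (fun i _ => ler0n _ _).
  - by rewrite /simple_form em.
  - by move=> i; rewrite -!natr1; ring.
  - by exists a, b; move: H; rewrite scale1r scale0r addr0.
have m1 : (1 < m.+1)%N.
  by rewrite ltnS lt0n; apply: contra_neq st => m0; apply: (cox_m1 hS); rewrite em m0.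
pose th : R := pi / m.+1%:R.
have mr0 : 0 < m.+1%:R :> R by rewrite ltr0n.
have mth : th * m.+1%:R = pi by rewrite /th divfK ?gt_eqF.
have th0 : 0 < th by rewrite divr_gt0 ?pi_gt0.
have sth0 : 0 < sin th.
  by apply: sin_gt0_pi; rewrite th0 /= ltr_pdivrMr // ltr_pMr ?pi_gt0 // ltr1n.
have [|||a [b H]] := @word_act_altword s t (cos th) (fun i => sin (th * i%:R) / sin th) k 0.
- by rewrite /simple_form em.
- move=> i; rewrite mulrA -mulrBl; congr (_ / _).
  have -> : th * i.+2%:R = th * i.+1%:R + th by rewrite -!natr1; ring.
  have -> : th * i%:R = th * i.+1%:R - th by rewrite -!natr1; ring.
  by rewrite sinB sinD; ring.
- move=> i ik; apply: divr_ge0; last exact: ltW.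
  apply: sin_ge0_pi; rewrite mulr_ge0 ?(ltW th0) //= -mth ler_pM2l // ler_nat.
  by rewrite (leq_trans ik) // add0n km.
- exists a, b; move: H.
  by rewrite mulr1 mulr0 sin0 mul0r scale0r addr0 divff ?gt_eqF // scale1r.
Qed.

(** Induction on length. Split off on the right a factor [l2] in the letters [s] and [t], [t] being
    the last letter of [l], as long as possible. The dihedral computation makes [l2] send [<<s>>] to
    a nonnegative combination of [<<s>>] and [<<t>>], and the shorter [l1] keeps both of these
    nonnegative by induction. *)
Lemma word_act_nonneg l s :
  reduced_word (rcons l s) -> nonneg (word_act l <<s>> : V).
Proof.
move: {2}(size l).+1 (ltnSn (size l)) => n.
elim: n l s => // n IH l s; rewrite ltnS.
case/lastP: l => [|l0 t] ln r; first exact: nonnegU.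
have st : s != t by apply/eqP => e; move: r; rewrite e; apply: not_reduced_ss.
have rl : reduced_word (rcons l0 t) by move: r; rewrite -cats1; apply: reduced_word_catl.
(* a factorization [l1 ++ l2] with [l2] over [{s, t}] of maximal length *)
pose P k := `[< exists l1 l2, [/\ word_prod (l1 ++ l2) = word_prod (rcons l0 t),
   size (l1 ++ l2) = size (rcons l0 t), all (fun y => (y == s) || (y == t)) l2
   & size l1 = k] >].
have ex : exists k, P k.
  exists (size l0); apply/asboolP; exists l0, [:: t].
  by rewrite cats1 /= eqxx orbT.
case: (ex_minnP ex) => k /asboolP[l1 [l2 [ep es al2 <-]]] mk.
(* The factorization of [l] as [l0] followed by [t] competes, so [l1] is strictly shorter than [l]
   and the induction hypothesis applies to it. *)
have kl0 : (size l1 <= size l0)%N.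
  apply: mk; apply/asboolP; exists l0, [:: t].
  by rewrite cats1 /= eqxx orbT.
have r12 : reduced_word (l1 ++ l2) by apply: reduced_word_prod rl.
have rl1 := reduced_word_catl r12.
have r1 y : (y == s) || (y == t) -> nonneg (word_act l1 <<y>> : V).
  move=> yst; apply: IH; first by rewrite (leq_trans _ ln) // size_rcons ltnS.
  (* Otherwise [y] could be moved from the end of [l1] to the front of [l2], against the minimality
     of [size l1]. *)
  apply: contrapT => nr; have [l' [e' s']] := not_reduced_rcons hS rl1 nr.
  have: (size l1 <= size l')%N; last by rewrite s' ltnn.
  apply: mk; apply/asboolP; exists l', (y :: l2); split=> //.
  - by rewrite -cat_rcons word_prod_cat -e' -word_prod_cat.
  - by rewrite -es !size_cat s' addnS.
  - by rewrite /= yst.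
have r2 : reduced_word (rcons l2 s).
  apply: (@reduced_word_catr _ _ l1).
  apply: reduced_word_prod r; rewrite -?rcons_cat ?size_rcons ?es ?size_rcons //.
  by rewrite word_prod_rcons -ep -word_prod_rcons.
have e2 := reduced_rcons_altword hS al2 r2.
have [|a [b [a0 b0 e]]] := @altword_nonneg s t (size l2) st.
  move=> m0; apply: (reduced_altword_size hS m0).
  by rewrite /= -e2.
rewrite -(geom_repE _ hS) -ep (geom_repE _ hS) word_act_cat e2 e.
rewrite word_actD !word_actZ.
by apply: nonneg_comb => //; apply: r1; rewrite eqxx ?orbT.
Qed.

End Positivity.

(** * Length, roots and inversion sets *)

Section Inversions.
Variables (W : groupType) (S : set W) (R : realType).
Hypothesis hS : coxeter_system S.
Local Notation V := {freeg S / R}.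
Local Notation act := (@geom_rep W S R).
Local Notation inv := (@inversions W S R).
Local Notation root := (@Defs.root W S R).
Implicit Types (s t : S) (l : seq S) (w x y : W) (u v a b c : V).

(** In a Coxeter system this set is a singleton: every element has a reduced word and all of them
    have the same size, so the default 0 is never taken. *)
Definition cox_length w : nat :=
  xget 0%N [set n | exists l, [/\ reduced_word l, word_prod l = w & size l = n]].

Lemma cox_length_prod l : reduced_word l -> cox_length (word_prod l) = size l.
Proof.
move=> r; rewrite /cox_length; case: xgetP => [n _ [l' [r' e <-]]|/(_ (size l)) []].
  by apply/eqP; rewrite eqn_leq r' // r.
by exists l.
Qed.

Lemma act_prod l v : act (word_prod l) v = word_act l v.
Proof. by rewrite geom_repE. Qed.

Lemma actM w x v : act (w * x)%g v = act w (act x v).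
Proof.
case: hS => _ gen _; case: (gen w) (gen x) => lw <- [lx <-].
by rewrite -word_prod_cat !act_prod word_act_cat.
Qed.

Lemma act1 v : act 1%g v = v.
Proof. by rewrite -(word_prod_nil S) act_prod. Qed.

Lemma actK w v : act w^-1%g (act w v) = v.
Proof. by rewrite -actM mulVg act1. Qed.

Lemma actVK w v : act w (act w^-1%g v) = v.
Proof. by rewrite -actM mulgV act1. Qed.

Lemma actD w u v : act w (u + v) = act w u + act w v.
Proof. by case: hS => _ /(_ w) [l <-] _; rewrite !act_prod word_actD. Qed.

Lemma actZ w (k : R) v : act w (k *: v) = k *: act w v.
Proof. by case: hS => _ /(_ w) [l <-] _; rewrite !act_prod word_actZ. Qed.

Lemma actN w v : act w (- v) = - act w v.
Proof. by rewrite -scaleN1r actZ scaleN1r. Qed.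

Lemma act_refl s v : act (val s) v = simple_reflection s v.
Proof. by rewrite -word_prod1 act_prod. Qed.

Lemma act_simple s : act (val s) <<s>> = - <<s>>.
Proof.
rewrite act_refl /simple_reflection coxBU simple_form_ss //.
by apply/eqP/freeg_eqP => y; rewrite !(coeffD, coeffN, coeffZ); ring.
Qed.

Lemma coxeter_invV s : ((val s)^-1 = val s)%g.
Proof. by apply: (@mulgI _ (val s)); rewrite mulgV cox_sq. Qed.

(** If appending [s] to a reduced word of [w] is not reduced, then [w] has a reduced word ending in
    [s], and [val s] negates [<<s>>]; both cases thus reduce to [word_act_nonneg]. *)
Lemma cox_lengthM1_cases w s :
  (cox_length (w * val s)%g = (cox_length w).+1 /\ nonneg (act w <<s>>)) \/
  (cox_length w = (cox_length (w * val s)%g).+1 /\ nonneg (- act w <<s>>)).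
Proof.
have [l <- r] := exists_reduced_word hS w.
have [rs|nr] := pselect (reduced_word (rcons l s)); [left|right].
  rewrite -word_prod_rcons !cox_length_prod // size_rcons; split => //.
  by rewrite act_prod; apply: word_act_nonneg.
have [l' [e se]] := not_reduced_rcons hS r nr.
have r' : reduced_word (rcons l' s).
  by apply: reduced_word_prod r => //; rewrite size_rcons.
have r'' : reduced_word l' by move: r'; rewrite -cats1; apply: reduced_word_catl.
have e' : (word_prod l * val s = word_prod l')%g.
  by rewrite e word_prod_rcons -mulgA (cox_sq hS) mulg1.
rewrite e' !cox_length_prod //; split => //.
rewrite e word_prod_rcons actM act_simple actN opprK act_prod.
exact: word_act_nonneg.
Qed.

Lemma coxeter_ind (P : W -> Prop) : P 1%g ->
  (forall w s, nonneg (act w <<s>>) -> P w -> P (w * val s)%g) -> forall w, P w.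
Proof.
move=> P1 PS w; have [l <-] := exists_reduced_word hS w.
elim/last_ind: l => [|l s IH] r; first by rewrite word_prod_nil.
rewrite word_prod_rcons; apply: PS; first by rewrite act_prod; apply: word_act_nonneg.
by apply: IH; move: r; rewrite -cats1; apply: reduced_word_catl.
Qed.

Lemma descent_exists w : w <> 1%g -> exists s,
  cox_length w = (cox_length (w * val s)%g).+1 /\ nonneg (- act w <<s>>).
Proof.
have [l <- r] := exists_reduced_word hS w.
elim/last_ind: l r => [|l s _] r; first by rewrite word_prod_nil.
move=> _; exists s; have [[] |//] := cox_lengthM1_cases (word_prod (rcons l s)) s.
rewrite {1}word_prod_rcons -mulgA (cox_sq hS) mulg1 !cox_length_prod //.
  by rewrite size_rcons => /eqP; rewrite -addn2 -[X in X == _]addn0 eqn_add2l.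
by move: r; rewrite -cats1; apply: reduced_word_catl.
Qed.

Lemma root_act w v : root v -> root (act w v).
Proof. by move=> [x [s ->]]; exists (w * x)%g, s; rewrite actM. Qed.

Lemma rootU s : root (<<s>> : V).
Proof. by exists 1%g, s; rewrite act1. Qed.

Lemma rootN v : root v -> root (- v).
Proof.
by move=> [x [s ->]]; exists (x * val s)%g, s; rewrite actM act_simple actN.
Qed.

Lemma root_sign v : root v -> nonneg v \/ nonneg (- v).
Proof. by move=> [w [s ->]]; have [[]|[]] := cox_lengthM1_cases w s; [left|right]. Qed.

Lemma root_neq0 v : root v -> v <> 0.
Proof.
move=> [w [s ->]] /(congr1 (act w^-1)%g); rewrite actK -(scale0r v) actZ scale0r.
by move/eqP; rewrite freegU_eq0 oner_eq0.
Qed.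

Lemma root_signN v : root v -> nonneg v -> ~ nonneg (- v).
Proof. by move=> rv h h'; apply: root_neq0 rv (nonneg_eq0 h h'). Qed.

(** Since [cox_form] evaluates its second argument inside the function lifted to the first,
    linearity there is linearity of [fglift] in the function. *)
Lemma fglift_addf (f g : S -> R^o) v :
  fglift (fun s => f s + g s) v = fglift f v + fglift g v.
Proof.
rewrite -(freeg_sumE v); elim: (dom v) => [|s d IH].
  by rewrite !big_nil -(subrr (0 : V)) !fgliftB !subrr addr0.
by rewrite !big_cons !fgliftD IH !liftU scalerDr addrACA.
Qed.

Lemma fglift_scalef (k : R) (f : S -> R^o) v :
  fglift (fun s => k * f s : R^o) v = k * fglift f v.
Proof.
rewrite -(freeg_sumE v); elim: (dom v) => [|s d IH].
  by rewrite !big_nil -(subrr (0 : V)) !fgliftB !subrr mulr0.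
rewrite !big_cons !fgliftD IH !liftU mulrDr; congr (_ + _).
by rewrite /GRing.scale /= mulrCA.
Qed.

Lemma cox_formDr u v v' : cox_form u (v + v') = cox_form u v + cox_form u v'.
Proof.
rewrite /cox_form -fglift_addf; apply: (congr1 (fun f : S -> R^o => fglift f u)).
by apply/funext => s; rewrite fgliftD.
Qed.

Lemma cox_formZr (k : R) u v : cox_form u (k *: v) = k * cox_form u v.
Proof.
rewrite /cox_form -fglift_scalef; apply: (congr1 (fun f : S -> R^o => fglift f u)).
by apply/funext => s; rewrite fgliftZ.
Qed.

Lemma cox_formDl u u' v : cox_form (u + u') v = cox_form u v + cox_form u' v.
Proof. by rewrite /cox_form fgliftD. Qed.

Lemma cox_formZl (k : R) u v : cox_form (k *: u) v = k * cox_form u v.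
Proof. by rewrite /cox_form fgliftZ. Qed.

Lemma cox_formUC s v : cox_form v <<s>> = cox_form <<s>> v.
Proof.
rewrite coxB /cox_form; apply: (congr1 (fun f : S -> R^o => fglift f v)); apply/funext => t.
by rewrite liftU scale1r simple_formC.
Qed.

(** Reflections preserve the form and simple roots have norm 1. This normalization excludes proper
    multiples of simple roots. *)
Lemma cox_form_root v : root v -> cox_form v v = 1.
Proof.
have H s u : cox_form (simple_reflection s u) (simple_reflection s u) = cox_form u u.
  rewrite /simple_reflection -scaleNr !(cox_formDr, cox_formDl, cox_formZr, cox_formZl).
  rewrite coxBU simple_form_ss // cox_formUC; ring.
move=> [w [s ->]]; case: hS => _ /(_ w) [l <-] _; rewrite act_prod.
elim: l => /= [|t l IH]; last by rewrite H.
by rewrite coxBU simple_form_ss.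
Qed.

(** The reflection changes only the coefficient at [s]. If the result were negative, all other
    coefficients of [v] would vanish, and norm 1 would force [v = <<s>>]. *)
Lemma nonneg_act_simple s v : root v -> nonneg v -> v <> <<s>> ->
  nonneg (act (val s) v).
Proof.
move=> rv v0 ne; have [//|neg] := root_sign (root_act (val s) rv).
case: ne; have ev : v = (coeff s v) *: <<s>>.
  apply/eqP/freeg_eqP => t; rewrite coeffZ coeffU mul1r; case: eqVneq => [->|st].
    by rewrite mulr1.
  rewrite mulr0; apply/eqP; rewrite eq_le v0 andbT.
  have := neg t; rewrite act_refl /simple_reflection coeffN coeffB coeffZ coeffU.
  by rewrite (negbTE st) !mulr0 subr0 oppr_ge0.
have := cox_form_root rv; rewrite ev cox_formZl cox_formZr coxBU simple_form_ss //.
rewrite mulr1 -expr2 => /eqP; rewrite sqrf_eq1 => /orP[/eqP->|/eqP k].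
  by rewrite scale1r.
by have := v0 s; rewrite k lerNr oppr0 ler10.
Qed.

Lemma inversionsE w a :
  inv w a <-> [/\ root a, nonneg a & nonneg (- act w^-1%g a)].
Proof.
split=> [[[ra a0] [b [rb b0] e]]|[ra a0 h]]; first by split=> //; rewrite -e opprK.
split=> //; exists (- act w^-1%g a); last by rewrite opprK.
by split=> //; apply/rootN/root_act.
Qed.

Lemma inversions1 : inv 1%g = set0.
Proof.
rewrite -subset0 => a /inversionsE[ra a0]; rewrite invg1 act1.
exact: root_signN.
Qed.

(** As [val s] permutes the positive roots other than [<<s>>], the signs of [act w^-1 a] and of its
    image under [val s] differ only if [act w^-1 a] is plus or minus [<<s>>]; minus is impossible
    for positive [a], since [act w <<s>>] is positive. *)
Lemma inversionsM1 w s : nonneg (act w <<s>>) ->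
  inv (w * val s)%g = inv w `|` [set act w <<s>>].
Proof.
move=> ws0; have e a : act (w * val s)^-1%g a = act (val s) (act w^-1%g a).
  by rewrite invgM coxeter_invV actM.
apply/seteqP; split=> a.
  move=> /inversionsE[ra a0]; rewrite e => h.
  have [ea|ne] := pselect (act w^-1%g a = <<s>>).
    by right; rewrite /= -ea actVK.
  left; apply/inversionsE; split=> //.
  have [p|//] := root_sign (root_act w^-1%g ra).
  have q := nonneg_act_simple (root_act _ ra) p ne.
  by case: (root_signN (root_act _ (root_act _ ra)) q h).
move=> [/inversionsE[ra a0 h]|->]; apply/inversionsE; rewrite e; split=> //.
- rewrite -actN; apply: nonneg_act_simple => //; first by apply/rootN/root_act.
  move=> /(congr1 (act w)); rewrite actN actVK => ea.
  by apply: (root_signN ra a0); rewrite ea.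
- exact/root_act/rootU.
- by rewrite actK act_simple opprK; apply: nonnegU.
Qed.

Lemma inversions_simple w s : nonneg (act w <<s>>) -> inv (w * val s)%g (act w <<s>>).
Proof. by move=> h; rewrite inversionsM1 //; right. Qed.

(** Take a descent [s] of [w^-1 * x], so that [w^-1] makes [act x <<s>>] negative. Were
    [act x <<s>>] itself negative, its opposite would be an inversion of [x], hence of [w], a
    contradiction; so it is a positive root inverted by [w]. *)
Lemma inversions_step x w : inv x `<=` inv w -> x <> w -> exists s,
  [/\ nonneg (act x <<s>>), inv (x * val s)%g `<=` inv w
    & (cox_length (w^-1 * (x * val s)) < cox_length (w^-1 * x))%N%g].
Proof.
move=> xw ne; have [|s [ls ns]] := @descent_exists (w^-1 * x)%g.
  by move=> /(congr1 (fun z => w * z)%g); rewrite mulVKg mulg1.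
rewrite actM in ns.
have rx : root (act x <<s>>) by apply/root_act/rootU.
exists s; have [x0|xn] := root_sign rx.
  split=> //; last by rewrite ls mulgA.
  rewrite inversionsM1 // => a [/xw //|->].
  by apply/inversionsE.
suff /xw /inversionsE[_ _] : inv x (- act x <<s>>).
  by rewrite actN => /(root_signN (rootN (root_act _ rx)) ns).
apply/inversionsE; split=> //; first exact: rootN.
by rewrite actN opprK actK; apply: nonnegU.
Qed.

(** Iterate [inversions_step] until [x] reaches [w]. Every step is an ascent, so lengths add:
    inclusion of inversion sets is the prefix order. *)
Lemma inversions_path x w : inv x `<=` inv w ->
  exists l, w = (x * word_prod l)%g /\ cox_length w = (cox_length x + size l)%N.
Proof.
move: {2}(cox_length _).+1 (ltnSn (cox_length (w^-1 * x)%g)) => n.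
elim: n x => // n IH x ln xw.
have [->|ne] := pselect (x = w).
  by exists [::]; rewrite word_prod_nil mulg1 addn0.
have [s [x0 xsw lt]] := inversions_step xw ne.
have [|l [e el]] := IH _ _ xsw; first exact: leq_trans lt ln.
exists (s :: l); rewrite word_prod_cons mulgA; split=> //.
have [[ls _]|[_ xn]] := cox_lengthM1_cases x s; last first.
  by case: (root_signN (root_act x (rootU s)) x0 xn).
by rewrite el ls /= addSnnS.
Qed.

Lemma cox_length_le x w : inv x `<=` inv w -> (cox_length x <= cox_length w)%N.
Proof. by move=> /inversions_path[l [_ ->]]; apply: leq_addr. Qed.

Lemma inversions_len_inj x w :
  inv x `<=` inv w -> (cox_length w <= cox_length x)%N -> x = w.
Proof.
move=> /inversions_path[l [-> ->]]; rewrite -{2}[cox_length x]addn0 leq_add2l leqn0.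
by move=> /nilP ->; rewrite word_prod_nil mulg1.
Qed.

Lemma inversions_inj x w : inv x = inv w -> x = w.
Proof.
by move=> e; apply: inversions_len_inj; [rewrite e|apply: cox_length_le; rewrite e].
Qed.

(** Inversion sets are finite, being built one root at a time along a reduced word. *)
Lemma inversions_compact (X : nat -> set V) x :
  (forall n, X n `<=` X n.+1) -> inv x `<=` \bigcup_n X n ->
  exists n, inv x `<=` X n.
Proof.
move=> /subset_chain Xle.
elim/coxeter_ind: x => [|x s x0 IH].
  by exists 0%N; rewrite inversions1.
rewrite inversionsM1 // => h; have [|n xn] := IH; first by move=> a xa; apply: h; left.
have [|m _ ym] := h (act x <<s>>); first by right.
exists (maxn n m) => a [/xn|->]; first exact: (Xle _ _ (leq_maxl n m) a).
exact: (Xle _ _ (leq_maxr n m)) ym.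
Qed.

End Inversions.

(** * Joins of elements below a closed set of roots *)

Section Joins.
Variables (W : groupType) (S : set W) (R : realType).
Hypothesis hS : coxeter_system S.
Local Notation V := {freeg S / R}.
Local Notation act := (@geom_rep W S R).
Local Notation inv := (@inversions W S R).
Local Notation root := (@Defs.root W S R).
Implicit Types (s t : S) (l : seq S) (w x y z : W) (u v a b c : V) (Y : set V).

Definition root_closed Y : Prop := forall b c (p q : R),
  0 <= p -> 0 <= q -> Y b -> Y c -> root (p *: b + q *: c) -> Y (p *: b + q *: c).

Lemma root_closed_inversions w : root_closed (inv w).
Proof.
move=> b c p q p0 q0 /(inversionsE hS)[_ b0 nb] /(inversionsE hS)[_ c0 nc] r.
apply/inversionsE => //; split=> //; first exact: nonneg_comb.
by rewrite -actN // opprD -!scalerN actD // !actZ // !actN //; apply: nonneg_comb.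
Qed.

Lemma root_closedI Y Y' : root_closed Y -> root_closed Y' -> root_closed (Y `&` Y').
Proof.
move=> h h' b c p q p0 q0 [Yb Yb'] [Yc Yc'] r.
by split; [apply: h|apply: h'].
Qed.

Lemma root_closed_bigcap I (D : set I) (F : I -> set V) :
  (forall i, D i -> root_closed (F i)) -> root_closed (\bigcap_(i in D) F i).
Proof.
move=> h b c p q p0 q0 Yb Yc r i Di.
by apply: h => //; [apply: Yb|apply: Yc].
Qed.

Lemma root_closed_bigcup (X : nat -> set V) : (forall n, X n `<=` X n.+1) ->
  (forall n, root_closed (X n)) -> root_closed (\bigcup_n X n).
Proof.
move=> /subset_chain XS h b c p q p0 q0 [m _ Xb] [n _ Xc] r.
exists (maxn m n) => //; apply: h => //.
  exact: (XS _ _ (leq_maxl m n)).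
exact: (XS _ _ (leq_maxr m n)).
Qed.

Lemma root_sign2 s t (p q : R) : s != t -> root (p *: <<s>> + q *: <<t>>) ->
  (0 <= p /\ 0 <= q) \/ (p <= 0 /\ q <= 0).
Proof.
move=> st r; have cs : coeff s (p *: <<s>> + q *: <<t>> : V) = p.
  by rewrite coeffD !coeffZ !coeffU eqxx eq_sym (negbTE st) !mulr1 !mulr0 addr0.
have ct : coeff t (p *: <<s>> + q *: <<t>> : V) = q.
  by rewrite coeffD !coeffZ !coeffU eqxx (negbTE st) !mulr1 !mulr0 add0r.
have [h|h] := root_sign hS r; have := h s; have := h t.
  by rewrite cs ct; left.
by rewrite !coeffN cs ct !oppr_ge0; right.
Qed.

Definition span2 s t : set V := [set v | exists p q : R, v = p *: <<s>> + q *: <<t>>].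

Lemma span2_simple s t r v : (r == s) || (r == t) ->
  span2 s t v -> span2 s t (act (val r) v).
Proof.
move=> rst [p [q ->]]; rewrite act_refl //.
case/orP: rst => /eqP ->; rewrite /simple_reflection; set k := 2 * _.
  exists (p - k), q; apply/eqP/freeg_eqP => y; rewrite !(coeffD, coeffN, coeffZ); ring.
exists p, (q - k); apply/eqP/freeg_eqP => y; rewrite !(coeffD, coeffN, coeffZ); ring.
Qed.

(* [j] is [z x] with [x] of maximal length among the elements that preserve
   the plane of [s] and [t] and satisfy [z <= z x], [inv (z x)] in [Y]. *)
Lemma dihedral_join Y w z s t : root_closed Y -> Y `<=` inv w -> s != t ->
  nonneg (act z <<s>>) -> nonneg (act z <<t>>) ->
  inv (z * val s)%g `<=` Y -> inv (z * val t)%g `<=` Y ->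
  exists j, [/\ inv j `<=` Y, inv (z * val s)%g `<=` inv j
    & inv (z * val t)%g `<=` inv j].
Proof.
move=> Yc Yw st zs zt Ys Yt.
have zr r : (r == s) || (r == t) -> nonneg (act z <<r>>).
  by move=> /orP[]/eqP->.
have sp r : (r == s) || (r == t) -> span2 s t <<r>>.
  move=> /orP[]/eqP->; [exists 1, 0|exists 0, 1];
  by rewrite scale1r scale0r ?addr0 ?add0r.
(* Stability under the inverse is included because inversions of [z * x] are tested through
   [x^-1]. *)
pose P x := forall v, span2 s t v -> span2 s t (act x v) /\ span2 s t (act x^-1%g v).
pose Q n := `[< exists x, [/\ P x, inv z `<=` inv (z * x)%g, inv (z * x)%g `<=` Y
                   & cox_length S (z * x)%g = n] >].
have exQ : exists n, Q n.
  exists (cox_length S z); apply/asboolP; exists 1%g; rewrite mulg1; split=> //.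
    by move=> v; rewrite invg1 act1.
  by apply: subset_trans Ys; rewrite inversionsM1 // => a; left.
have bQ n : Q n -> (n <= cox_length S w)%N.
  move=> /asboolP[x [_ _ xY <-]]; apply: (@cox_length_le _ _ R hS).
  exact: subset_trans xY Yw.
case: (ex_maxnP exQ bQ) => n /asboolP[x [Px zx xY <-]] mx.
(* No ascent by [s] or [t] is left: a positive [act (z * x) <<r>>] would be a nonnegative
   combination of [act z <<s>>] and [act z <<t>>], hence in [Y] by closure, and [z * x * val r]
   would be a longer candidate. *)
have neg r : (r == s) || (r == t) -> nonneg (- act (z * x)%g <<r>>).
  move=> rst; have rr : root (act (z * x)%g <<r>>) by apply/root_act/rootU.
  have [pos|//] := root_sign hS rr.
  have [[p [q e]] _] := Px _ (sp _ rst).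
  have ez : act (z * x)%g <<r>> = p *: act z <<s>> + q *: act z <<t>>.
    by rewrite actM // e actD // !actZ.
  have [|[p0 q0]|[p0 q0]] := @root_sign2 s t p q st.
  - by rewrite -e; apply/root_act/rootU.
  - have: (cox_length S (z * x * val r)%g <= cox_length S (z * x)%g)%N.
      apply: mx; apply/asboolP; exists (x * val r)%g; rewrite mulgA; split=> //.
      + move=> v sv; rewrite actM // invgM coxeter_invV // actM //; split.
          by apply: (Px _ _).1; apply: span2_simple.
        by apply: span2_simple => //; apply: (Px _ _).2.
      + by apply: subset_trans zx _; rewrite inversionsM1 // => a; left.
      + rewrite inversionsM1 // => a [/xY //|->]; rewrite ez; apply: Yc => //.
        * by apply: Ys; apply: inversions_simple.
        * by apply: Yt; apply: inversions_simple.
        * by rewrite -ez.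
    have [[-> _]|[_ ng]] := cox_lengthM1_cases R hS (z * x)%g r; first by rewrite ltnn.
    by case: (root_signN hS rr pos ng).
  - case: (root_signN hS rr pos); rewrite ez opprD -!scaleNr.
    by apply: nonneg_comb; rewrite ?oppr_ge0.
(* By [neg], [z * x] makes nonnegative roots of the plane negative. As it sends [act x^-1 <<r>>] to
   the positive root [act z <<r>>], that root of the plane must be negative. *)
have mem r : (r == s) || (r == t) -> inv (z * x)%g (act z <<r>>).
  move=> rst; have rr : root (act z <<r>>) by apply/root_act/rootU.
  apply/inversionsE => //; split=> //; first exact: zr.
  rewrite invgM actM // actK //; have [_ [p [q e]]] := Px _ (sp _ rst).
  have [|[p0 q0]|[p0 q0]] := @root_sign2 s t p q st.
  - by rewrite -e; apply/root_act/rootU.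
  - case: (root_signN hS rr (zr _ rst)).
    have -> : act z <<r>> = act (z * x)%g (act x^-1%g <<r>>) by rewrite actM // actVK.
    rewrite e actD // !actZ // opprD -!scalerN.
    by apply: nonneg_comb => //; apply: neg; rewrite eqxx ?orbT.
  - by rewrite e opprD -!scaleNr; apply: nonneg_comb; rewrite ?oppr_ge0 //; apply: nonnegU.
exists (z * x)%g; split=> //.
  by rewrite inversionsM1 // => a [/zx //|->]; apply: mem; rewrite eqxx.
by rewrite inversionsM1 // => a [/zx //|->]; apply: mem; rewrite eqxx orbT.
Qed.

Lemma bounded_join Y w x y : root_closed Y -> Y `<=` inv w ->
  inv x `<=` Y -> inv y `<=` Y ->
  exists j, [/\ inv j `<=` Y, inv x `<=` inv j & inv y `<=` inv j].
Proof.
move=> Yc Yw.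
(* The induction is on the length gap between [w] and a common lower bound [z], starting from
   [z = 1]. *)
suff H n z x' y' : (cox_length S w - cox_length S z < n)%N ->
    inv z `<=` inv x' -> inv z `<=` inv y' -> inv x' `<=` Y -> inv y' `<=` Y ->
    exists j, [/\ inv j `<=` Y, inv x' `<=` inv j & inv y' `<=` inv j].
  by move=> xY yY; apply: (H _ 1%g _ _ (ltnSn _)) => //; rewrite inversions1 //; apply: sub0set.
elim: n z {x y}x' y' => // n IH z x y ln zx zy xY yY.
have [e|zx_ne] := pselect (z = x); first by exists y; split=> //; rewrite -e.
have [e|zy_ne] := pselect (z = y); first by exists x; split=> //; rewrite -e.
have [s [zs sx _]] := inversions_step hS zx zx_ne.
have [t [zt ty _]] := inversions_step hS zy zy_ne.
have sY := subset_trans sx xY; have tY := subset_trans ty yY.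
have lt r : nonneg (act z <<r>>) -> inv (z * val r)%g `<=` Y ->
    (cox_length S w - cox_length S (z * val r)%g < n)%N.
  move=> zr rY; have := cox_length_le hS (subset_trans rY Yw).
  have [[-> _]|[_ ng]] := cox_lengthM1_cases R hS z r; last first.
    by case: (root_signN hS (root_act hS z (rootU R hS r)) zr ng).
  by move=> h; move: ln; rewrite -(subnSK h) ltnS.
have [e|st] := eqVneq s t.
  by rewrite -e in ty; apply: IH sx ty xY yY; apply: lt.
(* [j] closes the diamond over [z]; then induction at [z * val s] joins [x] with [j] into [k], and
   induction at [z * val t] joins [k] with [y]. *)
have [j [jY sj tj]] := dihedral_join Yc Yw st zs zt sY tY.
have [k [kY xk jk]] := IH _ _ _ (lt _ zs sY) sx sj xY jY.
have [m [mY km ym]] := IH _ _ _ (lt _ zt tY) (subset_trans tj jk) ty kY yY.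
by exists m; split=> //; apply: subset_trans km.
Qed.

(** An element of maximal length equals its upper bound with any other element, since that bound
    cannot be longer. *)
Lemma directed_max (P : W -> Prop) N : P 1%g ->
  (forall x y, P x -> P y -> exists j, [/\ P j, inv x `<=` inv j & inv y `<=` inv j]) ->
  (forall x, P x -> (cox_length S x <= N)%N) ->
  exists2 m, P m & forall x, P x -> inv x `<=` inv m.
Proof.
move=> P1 dir bd.
pose Q n := `[< exists2 x, P x & cox_length S x = n >].
have exQ : exists n, Q n by exists (cox_length S 1%g); apply/asboolP; exists 1%g.
have bQ n : Q n -> (n <= N)%N by move=> /asboolP[x Px <-]; apply: bd.
case: (ex_maxnP exQ bQ) => n /asboolP[m Pm <-] mx.
exists m => // x Px; have [j [Pj mj xj]] := dir _ _ Pm Px.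
by rewrite (inversions_len_inj hS mj) //; apply: mx; apply/asboolP; exists j.
Qed.

Lemma max_below Y w : root_closed Y -> Y `<=` inv w ->
  exists2 m, inv m `<=` Y & forall x, inv x `<=` Y -> inv x `<=` inv m.
Proof.
move=> Yc Yw; apply: (@directed_max _ (cox_length S w)).
- by rewrite inversions1 //; apply: sub0set.
- by move=> x y; apply: bounded_join Yw.
- by move=> x xY; apply: (@cox_length_le _ _ R hS); apply: subset_trans xY Yw.
Qed.

End Joins.

(** * Infinite reduced expressions as limits of increasing chains *)

Section InfiniteWords.
Variables (W : groupType) (S : set W) (R : realType).
Hypothesis hS : coxeter_system S.
Local Notation inv := (@inversions W S R).
Local Notation infinv := (@inf_inversions W S R).
Implicit Types (s t : S) (l : seq S) (w x y z : W) (e : inf_expr S).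

Definition prefix_elt e (k : nat) : W := word_prod (mkseq (val e) k).

Lemma reduced_mkseq e k : reduced_word (mkseq (val e) k).
Proof. by case: k => [l' _ //|k]; case: e => f /= /asboolP; apply. Qed.

Arguments reduced_mkseq : clear implicits.

Lemma cox_length_prefix e k : cox_length S (prefix_elt e k) = k.
Proof. by rewrite cox_length_prod ?size_mkseq //; apply: reduced_mkseq. Qed.

Lemma inversions_prefix e k : inv (prefix_elt e k) `<=` inv (prefix_elt e k.+1).
Proof.
have := reduced_mkseq e k.+1; rewrite /prefix_elt mkseqS => r.
rewrite word_prod_rcons inversionsM1 //.
by rewrite act_prod //; apply: word_act_nonneg.
Qed.

(** Adding the index 0 is harmless, as each term lies in the next; the union becomes that of an
    increasing sequence over all of [nat]. *)
Lemma inf_inversionsE e : infinv e = \bigcup_k inv (prefix_elt e k).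
Proof.
apply/seteqP; split=> a [k _ ka]; first by exists k.
by exists k.+1 => //; apply: inversions_prefix.
Qed.

Lemma inversions_catl l1 l2 : reduced_word (l1 ++ l2) ->
  inv (word_prod l1) `<=` inv (word_prod (l1 ++ l2)).
Proof.
elim/last_ind: l2 => [|l2 s IH]; first by rewrite cats0 => _ a.
rewrite -rcons_cat => r.
have r' : reduced_word (l1 ++ l2) by move: r; rewrite -cats1; apply: reduced_word_catl.
apply: subset_trans (IH r') _.
rewrite word_prod_rcons inversionsM1 //.
by rewrite act_prod //; apply: word_act_nonneg.
Qed.

Lemma reduced_of_size l : size l = cox_length S (word_prod l) -> reduced_word l.
Proof.
have [l' e r'] := exists_reduced_word hS (word_prod l).
by rewrite -{1}e cox_length_prod // => el; apply: reduced_word_prod r'.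
Qed.

(** By [inversions_path] one can choose reduced words of the [x n], each a prefix of the next. Their
    limit is infinite by unboundedness, and its prefixes interleave with these words, so the two
    unions agree. *)
Lemma chain_inf_expr (x : nat -> W) :
  (forall n, inv (x n) `<=` inv (x n.+1)) ->
  (forall N, exists n, (N < cox_length S (x n))%N) ->
  exists e, infinv e = \bigcup_n inv (x n).
Proof.
move=> xS xN; have [ext extP] := choice (fun n => inversions_path hS (xS n)).
have [l0 l0x l0r] := exists_reduced_word hS (x 0%N).
pose wd := fix wd n := if n is n'.+1 then wd n' ++ ext n' else l0.
have wdx n : word_prod (wd n) = x n.
  by elim: n => //= n IH; rewrite word_prod_cat IH; case: (extP n) => <-.
have wds n : size (wd n) = cox_length S (x n).
  elim: n => [|n IH] /=; first by rewrite -l0x cox_length_prod.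
  by rewrite size_cat IH; case: (extP n) => _ <-.
have wdr n : reduced_word (wd n) by apply: reduced_of_size; rewrite wds wdx.
have wdcat m n : (m <= n)%N -> exists p, wd n = wd m ++ p.
  move=> /subnKC <-; elim: (n - m)%N => [|k [p IH]].
    by exists [::]; rewrite addn0 cats0.
  by exists (p ++ ext (m + k)%N); rewrite addnS /= IH catA.
have [N NP] := choice xN.
have wdN k : (k < size (wd (N k)))%N by rewrite wds.
have [s0 _] : exists s : S, True.
  by move: (wdN 0%N); case: (wd _) => // s _ _; exists s.
(* The word [wd (N k)] is long enough to have a letter at position [k], so the default [s0] is never
   read; [fE] shows that any other long enough [wd n] gives the same letter. *)
pose f k := nth s0 (wd (N k)) k.
have fE n k : (k < size (wd n))%N -> f k = nth s0 (wd n) k.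
  move=> kn; rewrite /f; case: (leqP n (N k)) => [/wdcat|/ltnW/wdcat] [p ->].
    by rewrite nth_cat kn.
  by rewrite nth_cat wdN.
have fT n k : (k <= size (wd n))%N -> mkseq f k = take k (wd n).
  move=> kn; apply: (@eq_from_nth _ s0); first by rewrite size_mkseq size_takel.
  move=> i; rewrite size_mkseq => ik.
  by rewrite nth_mkseq // nth_take // (fE n) // (leq_trans ik).
have fr : inf_reduced f.
  move=> k _; rewrite (fT (N k)); last exact: ltnW.
  by apply: (@reduced_word_catl _ _ _ (drop k (wd (N k)))); rewrite cat_take_drop.
exists (exist _ f (asboolT fr)).
rewrite inf_inversionsE; apply/seteqP; split=> a [k _].
  rewrite /prefix_elt /= (fT (N k)); last exact: ltnW.
  have := @inversions_catl (take k (wd (N k))) (drop k (wd (N k))).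
  rewrite cat_take_drop wdx => h /h ka; exists (N k) => //.
  exact: ka.
move=> ka; exists (size (wd k)) => //.
by rewrite /prefix_elt /= (fT k) // take_size wdx.
Qed.

End InfiniteWords.

(** * Antisymmetry and meets in the weak order *)

Section WeakOrder.
Variables (W : groupType) (S : set W) (R : realType).
Hypothesis hS : coxeter_system S.
Local Notation inv := (@inversions W S R).
Local Notation infinv := (@inf_inversions W S R).
Local Notation Winv := (@Wbar_inversions W S R).
Implicit Types (w x y : W) (e : inf_expr S) (b c : Wbar S R).

Lemma Wbar_inversions_pi e : Winv (inl (\pi_(inf_word S R) e)%qT) = infinv e.
Proof.
have : inf_equiv R (repr (\pi_(inf_word S R) e)%qT) e.
  by apply/(eqmodP (inf_equiv_equiv S R)); rewrite reprK.
by move=> /asboolP.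
Qed.

(** The prefix of length [cox_length w + 1] would lie below [w]. *)
Lemma inf_inversions_neq e w : infinv e <> inv w.
Proof.
move=> ew; have : inv (prefix_elt e (cox_length S w).+1) `<=` inv w.
  by rewrite -ew inf_inversionsE // => a ha; exists (cox_length S w).+1.
by move/(cox_length_le hS); rewrite cox_length_prefix // ltnn.
Qed.

Lemma Wbar_inversions_inj b c : Winv b = Winv c -> b = c.
Proof.
case: b c => [p|w] [q|x] /=.
- move=> e; congr inl; rewrite -(reprK p) -(reprK q).
  by apply/eqmodP/asboolP.
- by move=> /inf_inversions_neq.
- by move=> /esym /inf_inversions_neq.
- by move=> /(inversions_inj hS) ->.
Qed.

Lemma root_closed_Wbar b : root_closed (Winv b).
Proof.
case: b => [p|w] /=; last exact: root_closed_inversions.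
rewrite inf_inversionsE //; apply: root_closed_bigcup.
  exact: inversions_prefix.
by move=> k; apply: root_closed_inversions.
Qed.

(** This treats both kinds of elements alike: prefixes for an infinite word, a constant sequence for
    an element of [W]. *)
Lemma Wbar_inf_approx b : exists x : nat -> W,
  (forall n, inv (x n) `<=` inv (x n.+1)) /\ Winv b = \bigcup_n inv (x n).
Proof.
case: b => [p|w] /=.
  exists (prefix_elt (repr p)); split; last exact: inf_inversionsE.
  exact: inversions_prefix.
exists (fun=> w); split=> [n a //|].
by apply/seteqP; split=> [a|a []//]; exists 0%N.
Qed.

(* An element of Wbar is determined by the elements of W below it, so the
   lower bounds of [A] are controlled by the [x] in W with [inv x] in [Y]. *)
Lemma Wbar_glb (A : set (Wbar S R)) : A !=set0 ->
  exists m, greatest_lower_bound (@weak_le W S R) A m.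
Proof.
move=> [a0 Aa0]; pose Y := \bigcap_(a in A) Winv a.
have Yc : root_closed Y by apply: root_closed_bigcap => a _; apply: root_closed_Wbar.
have [w [wS a0E]] := Wbar_inf_approx a0.
have xw n : exists m, inv m `<=` Y `&` inv (w n) /\
    forall y, inv y `<=` Y `&` inv (w n) -> inv y `<=` inv m.
  have [||m mY mx] := @max_below _ _ R hS (Y `&` inv (w n)) (w n).
  - by apply: root_closedI => //; apply: root_closed_inversions.
  - by move=> a [].
  - by exists m.
have [x xP] := choice xw.
have xS n : inv (x n) `<=` inv (x n.+1).
  by apply: (xP n.+1).2 => a /(xP n).1[Ya wa]; split=> //; apply: wS.
have xY n : inv (x n) `<=` Y by move=> a /(xP n).1[].
(* Since [Y] lies in the union of the [inv (w n)], compactness puts [inv y] inside a single one of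
   them. *)
have Yx y : inv y `<=` Y -> exists n, inv y `<=` inv (x n).
  move=> yY; have [|n yn] := @inversions_compact _ _ R hS (fun n => inv (w n)) y wS.
    by rewrite -a0E => a /yY; apply.
  by exists n; apply: (xP n).2 => a ya; split; [apply: yY|apply: yn].
(* It remains to realize the union of the [inv (x n)] by an element of [Wbar]. *)
have glb m : Winv m = \bigcup_n inv (x n) -> greatest_lower_bound (@weak_le W S R) A m.
  move=> mE; split=> [a Aa|b bA]; rewrite /weak_le mE.
    by move=> v [n _ /xY]; apply.
  have [y [yS bE]] := Wbar_inf_approx b.
  rewrite bE => v [k _ yv]; have [|n yn] := Yx (y k); last by exists n => //; apply: yn.
  by move=> v' yv' a /bA; rewrite /weak_le bE; apply; exists k.
have [unb|/existsNP[N bd]] := pselect (forall N, exists n, (N < cox_length S (x n))%N).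
  have [e eE] := chain_inf_expr hS xS unb.
  exists (inl (\pi_(inf_word S R) e)%qT); apply: glb.
  by rewrite Wbar_inversions_pi.
(* With lengths bounded by [N], the elements of [W] below [Y] are directed through the chain [x], so
   one of them is greatest. *)
have [|y z yY zY|y /Yx[n /(cox_length_le hS)]|m mY mx] :=
    @directed_max _ _ R hS (fun y => inv y `<=` Y) N.
- by rewrite inversions1.
- have [[n yn] [k zk]] := (Yx y yY, Yx z zY).
  exists (x (maxn n k)); split=> //.
    by apply: subset_trans yn _; apply: subset_chain xS _ _ (leq_maxl n k).
  by apply: subset_trans zk _; apply: subset_chain xS _ _ (leq_maxr n k).
- move=> le; apply: leq_trans le _; rewrite leqNgt; apply/negP => lt.
  by apply: bd; exists n.
exists (inr m); apply: glb => /=; apply/seteqP; split=> [v mv|v [n _ xv]].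
  by have [n mn] := Yx m mY; exists n => //; apply: mn.
exact: mx (@xY n) _ xv.
Qed.


End WeakOrder.

Theorem theorem2p9 (R : realType) (W : groupType) (S : set W) :
  coxeter_system S -> infinite_set [set: W] ->
  complete_meet_semilattice (@weak_le W S R).
Proof.
move=> hS _; split; last by move=> A; apply: Wbar_glb.
split=> [b v //|b c d bc cd v /bc /cd //|b c bc cb].
by apply: (Wbar_inversions_inj hS); apply/seteqP.
Qed.
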